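(* Let $\Gamma=(\gamma_1,\dots,\gamma_r)$ be a tuple of symmetric free polynomials in $x=(x_1,\dots,x_g)$ with $g\le r$ and $\gamma_j=x_j$ for $1\le j\le g$. Suppose $\mathcal K\subseteq\mathbb S(\mathbb C)^g$ is $\Gamma$-convex, contains $0$, and $\Gamma(0)=0$. If $Y\in\mathbb S_\ell(\mathbb C)^g$ and $\Gamma(Y)\notin\overline{\mathrm{matco}}(\Gamma(\mathcal K))(\ell)$, then there exists a monic $\Gamma$-pencil $L$ of size $\ell$ such that $L(X)\succ0$ for all $X\in\mathcal K$, but $L(Y)\not\succeq0$. In particular, if $\mathrm{matco}(\Gamma(\mathcal K))$ is closed, then for each $\ell$ and each $Y\in \mathbb S_\ell(\mathbb C)^g\setminus\mathcal K(\ell)$ there exists a monic $\Gamma$-pencil $L$ of size $\ell$ such that $L(X)\succ0$ for all $X\in\mathcal K$, but $L(Y)\not\succeq0$.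
   Context: Free polynomials are elements of the free algebra $\mathbb C\langle x\rangle$ in noncommuting variables $x_1,\dots,x_g$, with the conjugate-linear involution fixing each $x_j$ and reversing words; $p$ is symmetric if $p^*=p$. $\mathbb S_n(\mathbb C)$ is the set of self-adjoint $n\times n$ complex matrices and $\mathbb S(\mathbb C)^g=(\mathbb S_n(\mathbb C)^g)_{n\ge1}$. $\Gamma(X)=(\gamma_1(X),\dots,\gamma_r(X))\in\mathbb S_n(\mathbb C)^r$ for $X\in\mathbb S_n(\mathbb C)^g$. A subset $\mathcal K\subseteq\mathbb S(\mathbb C)^g$ is a sequence $(\mathcal K(n))_n$ with $\mathcal K(n)\subseteq\mathbb S_n(\mathbb C)^g$; topological notions are levelwise; $\Gamma(\mathcal K)$ is the levelwise image. $\mathcal K$ is a free set if it is closed under direct sums, simultaneous unitary similarity, and restriction to reducing subspaces. A $\Gamma$-pair is $(X,V)$ with $X\in\mathbb S_n(\mathbb C)^g$ and $V:\mathbb C^m\to\mathbb C^n$ an isometry such that $V^*\Gamma(X)V=\Gamma(V^*XV)$ (coordinatewise). $\mathcal K$ is $\Gamma$-convex if it is free and $V^*XV\in\mathcal K$ whenever $X\in\mathcal K$ and $(X,V)$ is a $\Gamma$-pair. Matrix convex means $\Gamma$-convex for $\Gamma(x)=x$, i.e. free and closed under compressions $X\mapsto V^*XV$ by all isometries. $\mathrm{matco}(\mathcal S)$, the matrix convex hull, is the intersection of all matrix convex sets containing $\mathcal S$, and $\overline{\mathrm{matco}}(\mathcal S)(n)$ is the closure of $\mathrm{matco}(\mathcal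 S)(n)$ for each $n$. A monic $\Gamma$-pencil of size $d$ is $L(x)=I_d+\sum_{j=1}^r A_j\gamma_j(x)$ with $A_j\in\mathbb S_d(\mathbb C)$, evaluated by $L(X)=I_d\otimes I_n+\sum_j A_j\otimes\gamma_j(X)$. $T\succeq0$ (resp. $T\succ 0$) means positive semidefinite (resp. positive definite). *)

(* Defs.v *)
From HB Require Import structures.
From mathcomp Require Import all_boot all_order all_algebra.
From mathcomp Require Import finmap complex mxtens spectral.
From mathcomp Require Import all_classical all_reals all_analysis.
(* The notations of [monalg] are incompatible with those of MathComp-Analysis. *)
From mathcomp Require Import -(notations) monalg.

Set Implicit Arguments.
Unset Strict Implicit.
Unset Printing Implicit Defensive.

Import Order.TTheory GRing.Theory Num.Theory.
Import numFieldNormedType.Exports.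

Local Open Scope classical_set_scope.
Local Open Scope ring_scope.
Local Open Scope sesquilinear_scope.

(* Typing the complex numbers as a [numClosedFieldType] is what gives them, and
   matrices over them, the usual norm topology: [R[i]] itself has none. *)
Definition Cplx (R : realType) : numClosedFieldType := R[i]%C.

Section FreePolynomials.
Variables (C : numClosedFieldType) (g : nat).

(* The free algebra C<x_1, ..., x_g>: the monoid algebra of the free monoid of
   words over ['I_g]. *)
Definition free_poly := malg (fmonom 'I_g) C.

Definition fp_var (i : 'I_g) : free_poly := mkmalgU (fmu i) 1.

Definition word_rev (w : fmonom 'I_g) : fmonom 'I_g := FMonom (rev w).

Definition fp_adj (p : free_poly) : free_poly :=
  \sum_(w <- msupp p) mkmalgU (word_rev w) (mcoeff w p)^*.

Definition fp_symmetric (p : free_poly) : Prop := fp_adj p = p.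

Definition fp_eval n (X : 'I_g -> 'M[C]_n.+1) (p : free_poly) : 'M[C]_n.+1 :=
  mmap (fun c : C => c%:M) (fun w : fmonom 'I_g => \prod_(i <- w) X i) p.

Definition fp_map r (Gamma : 'I_r -> free_poly) n (X : 'I_g -> 'M[C]_n.+1) :
  'I_r -> 'M[C]_n.+1 := fun j => fp_eval X (Gamma j).

End FreePolynomials.

Section Matrices.
Variable C : numClosedFieldType.

Definition selfadjoint k n (X : 'I_k -> 'M[C]_n) : Prop :=
  forall i, X i \is hermsymmx.

(* The matrix V stands for a linear map C^m -> C^n acting on column vectors. *)
Definition isometry n m (V : 'M[C]_(n, m)) : Prop := V^t* *m V = 1%:M.

Definition compress k n m (V : 'M[C]_(n, m)) (X : 'I_k -> 'M[C]_n) :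
  'I_k -> 'M[C]_m := fun i => V^t* *m X i *m V.

Definition direct_sum k n m (X : 'I_k -> 'M[C]_n) (Y : 'I_k -> 'M[C]_m) :
  'I_k -> 'M[C]_(n + m) := fun i => block_mx (X i) 0 0 (Y i).

(* The range of V is invariant under every X_i and every X_i^*. *)
Definition reducing k n m (X : 'I_k -> 'M[C]_n) (V : 'M[C]_(n, m)) : Prop :=
  forall (i : 'I_k) (v : 'cV[C]_m),
    (exists w : 'cV[C]_m, X i *m (V *m v) = V *m w) /\
    (exists w : 'cV[C]_m, (X i)^t* *m (V *m v) = V *m w).

(* In C, [0 <= z] and [0 < z] include that z is real. *)
Definition psdmx n (T : 'M[C]_n) : Prop :=
  T \is hermsymmx /\ forall v : 'cV[C]_n, 0 <= (v^t* *m T *m v) 0 0.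

Definition posdefmx n (T : 'M[C]_n) : Prop :=
  T \is hermsymmx /\ forall v : 'cV[C]_n, v != 0 -> 0 < (v^t* *m T *m v) 0 0.

End Matrices.

Section NCSets.
Variable C : numClosedFieldType.

(* Matrix sizes are >= 1, so the component of index n consists of k-tuples of
   matrices of size n.+1; each level carries the product topology. *)
Definition nc_set (k : nat) := forall n : nat, set {ptws 'I_k -> 'M[C]_n.+1}.

Definition nc_subset k (S T : nc_set k) : Prop := forall n, S n `<=` T n.

Definition nc_closed k (S : nc_set k) : Prop := forall n, closed (S n).

Definition nc_closure k (S : nc_set k) : nc_set k := fun n => closure (S n).

Definition nc_image g r (Gamma : 'I_r -> free_poly C g) (K : nc_set g) :
  nc_set r := fun n => [set fp_map Gamma X | X in K n].

(* In the last two clauses, [compress U X] is U^* X U and, for V an isometry onto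
   a reducing subspace, [compress V X] is the restriction of X to it, written in
   an orthonormal basis. *)
Definition free_set k (K : nc_set k) : Prop :=
  [/\ forall n X, K n X -> selfadjoint X,
      forall n m (X : 'I_k -> 'M[C]_n.+1) (Y : 'I_k -> 'M[C]_m.+1),
        K n X -> K m Y -> K (n + m.+1)%N (direct_sum X Y),
      forall n (X : 'I_k -> 'M[C]_n.+1) (U : 'M[C]_n.+1),
        K n X -> U \is unitarymx -> K n (compress U X) &
      forall n m (X : 'I_k -> 'M[C]_n.+1) (V : 'M[C]_(n.+1, m.+1)),
        K n X -> isometry V -> reducing X V -> K m (compress V X)].

Definition gamma_pair g r (Gamma : 'I_r -> free_poly C g) n m
    (X : 'I_g -> 'M[C]_n.+1) (V : 'M[C]_(n.+1, m.+1)) : Prop :=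
  [/\ selfadjoint X, isometry V &
      compress V (fp_map Gamma X) =1 fp_map Gamma (compress V X)].

Definition gamma_convex g r (Gamma : 'I_r -> free_poly C g) (K : nc_set g) :
    Prop :=
  free_set K /\
  forall n m (X : 'I_g -> 'M[C]_n.+1) (V : 'M[C]_(n.+1, m.+1)),
    K n X -> gamma_pair Gamma X V -> K m (compress V X).

Definition matrix_convex k (K : nc_set k) : Prop := gamma_convex (@fp_var C k) K.

Definition matco k (S : nc_set k) : nc_set k := fun n =>
  \bigcap_(T in [set T : nc_set k | matrix_convex T /\ nc_subset S T]) T n.

(* L(X) for the monic pencil L(x) = I + sum_j A_j gamma_j(x). *)
Definition monic_pencil g r (Gamma : 'I_r -> free_poly C g) d
    (A : 'I_r -> 'M[C]_d) n (X : 'I_g -> 'M[C]_n.+1) : 'M[C]_(d * n.+1) :=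
  (1%:M : 'M[C]_d) *t (1%:M : 'M[C]_n.+1) +
  \sum_(j < r) A j *t fp_eval X (Gamma j).

End NCSets.

Arguments nc_closure {C k} S n _.
Arguments nc_image {C g r} Gamma K n _.
Arguments matco {C k} S n _.

(* Main.v *)
Require Import Defs.
From mathcomp Require Import all_boot all_order all_algebra.
From mathcomp Require Import finmap complex mxtens spectral.
From mathcomp Require Import all_classical all_reals all_analysis.
From mathcomp Require Import -(notations) monalg.
From mathcomp Require Import ring lra.

(** The set of compressions V^* Gamma(X) V, with X in K and V an isometry, is
    matrix convex, hence equals matco(Gamma(K)); since Gamma(0) = 0 it is also
    stable under compression by contractions.  The pairs
    (V^* V, V^* Gamma(X) V), with V now arbitrary, form a convex cone P.  If
    Gamma(Y) is not in the closure of matco(Gamma(K)), then (1, Gamma(Y)) is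
    not in the closure of P: V^* V close to 1 makes V, up to a scalar close to
    1, a contraction.  A nearest-point argument then yields a real functional
    tr(T M) + sum_j tr(B_j W_j), nonnegative on P and negative at
    (1, Gamma(Y)).  Adding a small multiple of 1 to T makes T positive definite
    and the functional strictly positive at V <> 0; writing T = E^* E, the
    pencil has coefficients the transposes of E^-* B_j E^-1.  Closedness gives
    the second part because Gamma contains the coordinates: if
    Gamma(Y) = V^* Gamma(X) V then Y = V^* X V and (X, V) is a Gamma-pair. *)

Set Implicit Arguments.
Unset Strict Implicit.
Unset Printing Implicit Defensive.

Import Order.TTheory GRing.Theory Num.Theory.
Import numFieldNormedType.Exports.
(* MathComp shadows [isometry]. *)
Import Defs.

Local Open Scope classical_set_scope.
Local Open Scope ring_scope.
Local Open Scope sesquilinear_scope.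

(** * Hermitian matrices *)

Section Adjoint.
Variable C : numClosedFieldType.

Lemma hermsymmxP n (A : 'M[C]_n) : reflect (A^t* = A) (A \is hermsymmx).
Proof.
by apply: (iffP (is_hermitianmxP _ _ _)); rewrite expr0 scale1r.
Qed.

Lemma adjmxM m n p (A : 'M[C]_(m, n)) (B : 'M[C]_(n, p)) :
  (A *m B)^t* = B^t* *m A^t*.
Proof. by rewrite trmx_mul map_mxM. Qed.

Lemma adjmxD m n (A B : 'M[C]_(m, n)) : (A + B)^t* = A^t* + B^t*.
Proof. by rewrite linearD /= map_mxD. Qed.

Lemma adjmx_scalar n (c : C) : (c%:M : 'M[C]_n)^t* = (c^*)%:M.
Proof. by rewrite tr_scalar_mx map_scalar_mx. Qed.

Lemma adjmx1 n : (1%:M : 'M[C]_n)^t* = 1%:M.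
Proof. by rewrite adjmx_scalar rmorph1. Qed.

Lemma adjmx0 m n : (0 : 'M[C]_(m, n))^t* = 0.
Proof. by rewrite trmx0 map_mx0. Qed.

Lemma adjmxZ m n (c : C) (A : 'M[C]_(m, n)) : (c *: A)^t* = c^* *: A^t*.
Proof. by rewrite linearZ /= map_mxZ. Qed.

Lemma adjmx_sum m n I (s : seq I) (P : pred I) (F : I -> 'M[C]_(m, n)) :
  (\sum_(i <- s | P i) F i)^t* = \sum_(i <- s | P i) (F i)^t*.
Proof.
by apply: (big_morph (fun A : 'M[C]_(m, n) => A^t*));
  [exact: adjmxD | exact: adjmx0].
Qed.

Lemma mxE_adj m n (A : 'M[C]_(m, n)) i j : A^t* i j = (A j i)^*.
Proof. by rewrite !mxE. Qed.

Lemma mxtrace_adj n (A : 'M[C]_n) : \tr (A^t*) = (\tr A)^*.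
Proof. by rewrite /mxtrace rmorph_sum; apply: eq_bigr => i _; rewrite mxE_adj. Qed.

Lemma quad_form_self n (v : 'cV[C]_n) :
  (v^t* *m v) 0 0 = \sum_i `|v i 0| ^+ 2.
Proof. by rewrite mxE; apply: eq_bigr => i _; rewrite mxE_adj mulrC normCK. Qed.

Lemma quad_form_self_gt0 n (v : 'cV[C]_n) : v != 0 -> 0 < (v^t* *m v) 0 0.
Proof.
move=> v0; rewrite quad_form_self lt_neqAle sumr_ge0 ?andbT; last first.
  by move=> i _; rewrite exprn_ge0.
apply: contra v0 => /eqP/esym/psumr_eq0P H; apply/eqP/matrixP => i j.
by rewrite ord1 mxE; apply/eqP; rewrite -normr_eq0 -sqrf_eq0 H.
Qed.

Lemma hermsymmx_conj n m (A : 'M[C]_n) (V : 'M[C]_(n, m)) :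
  A \is hermsymmx -> V^t* *m A *m V \is hermsymmx.
Proof.
by move/hermsymmxP => hA; apply/hermsymmxP; rewrite !adjmxM trmxCK hA mulmxA.
Qed.

(** By the spectral theorem M = P^* D P with P unitary; positivity makes D nonnegative, and E =
    D^(1/2) P. *)
Lemma psdmx_factor n (M : 'M[C]_n) : psdmx M -> exists E : 'M[C]_n, M = E^t* *m E.
Proof.
case=> hM pM; have /orthomx_spectralP := hermitian_normalmx hM.
set P := spectralmx M; set d := spectral_diag M => defM.
have uP : P \is unitarymx := spectral_unitarymx M.
have d_ge0 i : 0 <= d 0 i.
  (* The form at the i-th eigenvector P^* e_i is the i-th eigenvalue. *)
  have := pM (P^t* *m delta_mx i 0); rewrite {1}defM invmx_unitary //.
  rewrite adjmxM trmxCK -!mulmxA !(mulmxA P (P^t* )) (unitarymxP uP) !mul1mx.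
  rewrite trmx_delta map_delta_mx mulmxA -rowE -colE !mxE eqxx.
  by rewrite mulr1n.
exists (diag_mx (map_mx sqrtC d) *m P).
rewrite adjmxM mulmxA -(mulmxA (P^t*)) tr_diag_mx map_diag_mx mulmx_diag.
rewrite {1}defM invmx_unitary //; congr (_ *m diag_mx _ *m _).
apply/rowP => i; rewrite !mxE.
by rewrite /= conj_Creal ?ger0_real ?sqrtC_ge0 // -expr2 sqrtCK.
Qed.

Lemma posdefmx_factor n (M : 'M[C]_n) :
  posdefmx M -> exists2 E : 'M[C]_n, E \in unitmx & M = E^t* *m E.
Proof.
case=> hM pM; case: (@psdmx_factor n M); first split=> // v.
  have [->|/pM/ltW//] := eqVneq v 0.
  by rewrite mulmx0 mxE.
(* If E were singular, the form of M = E^* E would vanish at a nonzero kernel vector of E. *)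
move=> E defM; exists E => //; rewrite -unitmx_tr -row_free_unit -kermx_eq0.
apply/eqP/row_matrixP => i; rewrite row0; apply/eqP; apply/negPn/negP => nz.
set w := row i _ in nz.
have w0 : w *m E^T = 0.
  by apply/sub_kermxP/row_sub.
have := pM w^T; rewrite trmx_eq0 nz => /(_ isT).
by rewrite defM -!mulmxA -{2}(trmxK E) -trmx_mul w0 trmx0 !mulmx0 mxE ltxx.
Qed.

End Adjoint.

(** * Evaluation of free polynomials *)

Section Evaluation.
Variables (C : numClosedFieldType) (g : nat).
Implicit Types p : free_poly C g.

Lemma fp_evalE n (X : 'I_g -> 'M[C]_n.+1) p :
  fp_eval X p = \sum_(w <- msupp p) mcoeff w p *: \prod_(i <- w) X i.
Proof.
rewrite /fp_eval mmapE; apply: eq_bigr => w _.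
by rewrite -mul_scalar_mx.
Qed.

Lemma fp_eval_monomial n (X : 'I_g -> 'M[C]_n.+1) w (c : C) :
  fp_eval X (mkmalgU w c) = c *: \prod_(i <- w) X i.
Proof.
by rewrite /fp_eval (@mmapU _ _ _ (@scalar_mx C n.+1)) -mul_scalar_mx.
Qed.

Lemma fp_eval_var n (X : 'I_g -> 'M[C]_n.+1) i : fp_eval X (fp_var C i) = X i.
Proof. by rewrite fp_eval_monomial scale1r fmuE big_seq1. Qed.

Lemma fp_eval_sum n (X : 'I_g -> 'M[C]_n.+1) I (s : seq I) (F : I -> free_poly C g) :
  fp_eval X (\sum_(i <- s) F i) = \sum_(i <- s) fp_eval X (F i).
Proof.
pose ev (w : fmonom 'I_g) := \prod_(i <- w) X i.
exact: (raddf_sum (mmap (@scalar_mx C n.+1) ev)).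
Qed.

Lemma prod_adj n (X : 'I_g -> 'M[C]_n.+1) (w : seq 'I_g) : selfadjoint X ->
  (\prod_(i <- w) X i)^t* = \prod_(i <- rev w) X i.
Proof.
move=> hX; elim: w => [|i w IH]; first by rewrite !big_nil adjmx1.
rewrite big_cons rev_cons -cats1 big_cat big_seq1 /= -IH.
by rewrite -[LHS]/((X i *m _)^t* ) adjmxM (hermsymmxP _ (hX i)).
Qed.

Lemma fp_eval_adj n (X : 'I_g -> 'M[C]_n.+1) p : selfadjoint X ->
  (fp_eval X p)^t* = fp_eval X (fp_adj p).
Proof.
move=> hX; rewrite /fp_adj fp_eval_sum fp_evalE adjmx_sum.
by apply: eq_bigr => w _; rewrite adjmxZ fp_eval_monomial prod_adj.
Qed.

(** The sizes [n.+1 + m.+1] and [(n + m.+1).+1] are convertible: blocks live at the first, ring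
    operations at the second, and the casts pass between them. *)
Lemma fp_eval_direct_sum n m (X : 'I_g -> 'M[C]_n.+1) (Y : 'I_g -> 'M[C]_m.+1) p :
  fp_eval (direct_sum X Y : 'I_g -> 'M[C]_((n + m.+1).+1)) p =
  block_mx (fp_eval X p) 0 0 (fp_eval Y p) :> 'M[C]_(n.+1 + m.+1).
Proof.
have hprod (w : seq 'I_g) :
    \prod_(i <- w) (direct_sum X Y i : 'M[C]_((n + m.+1).+1)) =
    block_mx (\prod_(i <- w) X i) 0 0 (\prod_(i <- w) Y i) :> 'M[C]_(n.+1 + m.+1).
  elim: w => [|i w IH]; first by rewrite !big_nil -scalar_mx_block.
  have := mulmx_block (X i) 0 0 (Y i)
    (\prod_(i <- w) X i) 0 0 (\prod_(i <- w) Y i).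
  by rewrite !mulmx0 !mul0mx !addr0 !add0r !big_cons IH => mulE; exact: mulE.
rewrite !fp_evalE; elim: (msupp p : seq _) => [|w s IH].
  by rewrite !big_nil block_mx0.
rewrite !big_cons hprod.
rewrite -[LHS]/(_ *: (_ : 'M[C]_(n.+1 + m.+1)) + (_ : 'M[C]_(n.+1 + m.+1))).
by rewrite IH scale_block_mx add_block_mx !scaler0 !addr0.
Qed.

End Evaluation.

(** * Compressions *)

Section Compressions.
Variables (C : numClosedFieldType) (g r : nat) (Gamma : 'I_r -> free_poly C g).
Hypothesis Gamma_sym : forall j, fp_symmetric (Gamma j).
Variable K : nc_set C g.
Arguments K n _ : clear implicits.
Hypothesis K_free : free_set K.

Definition compressions : nc_set C r := fun l =>
  [set W | exists n (X : 'I_g -> 'M[C]_n.+1) (V : 'M[C]_(n.+1, l.+1)),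
     [/\ K n X, isometry V & W = compress V (fp_map Gamma X)]].

Arguments compressions n _ : clear implicits.

Lemma selfadjoint_fp_map n (X : 'I_g -> 'M[C]_n.+1) :
  selfadjoint X -> selfadjoint (fp_map Gamma X).
Proof.
by move=> hX j; apply/hermsymmxP; rewrite fp_eval_adj // Gamma_sym.
Qed.

Lemma compressM k n m p (V : 'M[C]_(n, m)) (U : 'M[C]_(m, p)) (X : 'I_k -> 'M[C]_n) :
  compress U (compress V X) = compress (V *m U) X.
Proof. by apply/funext => i; rewrite /compress adjmxM !mulmxA. Qed.

Lemma isometryM n m p (V : 'M[C]_(n, m)) (U : 'M[C]_(m, p)) :
  isometry V -> isometry U -> isometry (V *m U).
Proof.
by move=> hV hU; rewrite /isometry adjmxM mulmxA -(mulmxA (U^t* )) hV mulmx1.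
Qed.

Lemma unitary_isometry n (U : 'M[C]_n) : U \is unitarymx -> isometry U.
Proof.
by rewrite -trmxC_unitary => /unitarymxP; rewrite trmxCK.
Qed.

Lemma isometry1 n : isometry (1%:M : 'M[C]_n).
Proof. by rewrite /isometry adjmx1 mulmx1. Qed.

Lemma compress1 k n (X : 'I_k -> 'M[C]_n) : compress 1%:M X = X.
Proof. by apply/funext => i; rewrite /compress adjmx1 mul1mx mulmx1. Qed.

Lemma compress_selfadjoint k n m (V : 'M[C]_(n, m)) (X : 'I_k -> 'M[C]_n) :
  selfadjoint X -> selfadjoint (compress V X).
Proof. by move=> hX i; apply: hermsymmx_conj. Qed.

Lemma compressions_isometry n m (W : 'I_r -> 'M[C]_n.+1) (V : 'M[C]_(n.+1, m.+1)) :
  compressions n W -> isometry V -> compressions m (compress V W).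
Proof.
move=> [p [X [U [KX hU ->]]]] hV; exists p, X, (U *m V).
by rewrite compressM; split=> //; exact: isometryM.
Qed.

Lemma direct_sum_adj n m p q (A : 'M[C]_(n, m)) (B : 'M[C]_(p, q)) :
  (block_mx A 0 0 B)^t* = block_mx (A^t* ) 0 0 (B^t* ).
Proof. by rewrite tr_block_mx map_block_mx !trmx0 !map_mx0. Qed.

Lemma compressions_direct_sum n m (W : 'I_r -> 'M[C]_n.+1) (Z : 'I_r -> 'M[C]_m.+1) :
  compressions n W -> compressions m Z ->
  compressions (n + m.+1)%N (direct_sum W Z).
Proof.
move=> [p [X [U [KX hU ->]]]] [q [Y [V [KY hV ->]]]].
have [_ Ksum _ _] := K_free.
exists (p + q.+1)%N, (direct_sum X Y).
set UV := (block_mx U 0 0 V : 'M[C]_(p.+1 + q.+1, n.+1 + m.+1)).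
exists UV; split.
- exact: Ksum.
- rewrite /isometry -[LHS]/(UV^t* *m UV) /UV.
  rewrite direct_sum_adj mulmx_block !mulmx0 !mul0mx !addr0 !add0r hU hV.
  by rewrite -scalar_mx_block.
- apply/funext => j; rewrite /compress /fp_map fp_eval_direct_sum.
  rewrite -[RHS]/(UV^t* *m
    block_mx (fp_eval X (Gamma j)) 0 0 (fp_eval Y (Gamma j)) *m UV) /UV.
  by rewrite direct_sum_adj 2!mulmx_block !(mulmx0, mul0mx, addr0, add0r).
Qed.

Lemma compressions_selfadjoint n (W : 'I_r -> 'M[C]_n.+1) :
  compressions n W -> selfadjoint W.
Proof.
move=> [p [X [U [KX hU ->]]]]; apply: compress_selfadjoint.
by have [Ksa _ _ _] := K_free; exact/selfadjoint_fp_map/Ksa.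
Qed.

Lemma compressions_matrix_convex : matrix_convex compressions.
Proof.
split; last first.
  by move=> n m W V SW [_ hV _]; exact: compressions_isometry.
split=> [n W||n W U SW|n m W V SW hV _].
- exact: compressions_selfadjoint.
- exact: compressions_direct_sum.
- by move/unitary_isometry; exact: compressions_isometry.
- exact: compressions_isometry.
Qed.

(** This makes the matrix convex hull explicit: every one of its points is a single compression of a
    single Gamma(X). *)
Lemma matco_compressions n : matco (nc_image Gamma K) n = compressions n.
Proof.
have [Ksa _ _ _] := K_free.
apply/seteqP; split=> W.
  move=> /(_ compressions); apply; split; first exact: compressions_matrix_convex.
  move=> m _ [X KX <-]; exists m, X, 1%:M.
  by rewrite compress1; split=> //; exact: isometry1.
move=> [p [X [U [KX hU ->]]]] T [[_ Tconv] subT]; apply: Tconv.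
  by apply: subT; exists X.
(* For the tuple of variables, every isometry forms a pair with every self-adjoint tuple. *)
split=> //; first exact/selfadjoint_fp_map/Ksa.
by move=> i; rewrite /fp_map /compress !fp_eval_var.
Qed.

Hypothesis K_0 : K 0%N (fun=> 0).
Hypothesis Gamma_0 :
  forall j : 'I_r, fp_eval (fun=> 0 : 'M[C]_1) (Gamma j) = 0.

(** The hypotheses concern 0 at size 1 only; direct sums carry them to every size. *)
Lemma zero_level n :
  K n (fun=> 0) /\ forall j, fp_eval (fun=> 0 : 'M[C]_n.+1) (Gamma j) = 0.
Proof.
have [_ Ksum _ _] := K_free.
elim: n => [|n [Kn Gn]]; first by split.
have sum0 : direct_sum (fun=> 0) (fun=> 0) =
    (fun=> 0) :> ('I_g -> 'M[C]_(1 + n.+1)).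
  by apply/funext => i; exact: block_mx0.
split; first by have := Ksum _ _ _ _ K_0 Kn; rewrite sum0.
move=> j; have := fp_eval_direct_sum (fun=> 0 : 'M[C]_1)
  (fun=> 0 : 'M[C]_n.+1) (Gamma j).
by rewrite sum0 Gamma_0 Gn => ->; exact: (@block_mx0 C 1 n.+1 1 n.+1).
Qed.

(* Compressing X by a contraction V is compressing X (+) 0 by the isometry
   obtained by stacking V on a square root of 1 - V^* V. *)
Lemma compressions_contraction n l (X : 'I_g -> 'M[C]_n.+1)
    (V : 'M[C]_(n.+1, l.+1)) :
  K n X -> psdmx (1%:M - V^t* *m V) -> compressions l (compress V (fp_map Gamma X)).
Proof.
move=> KX /psdmx_factor [E defE].
have [_ Ksum _ _] := K_free; have [K0 G0] := zero_level l.
exists (n + l.+1)%N, (direct_sum X (fun=> 0)).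
have adjVE : (col_mx V E)^t* = row_mx (V^t* ) (E^t* ).
  by rewrite tr_col_mx map_row_mx.
exists (col_mx V E : 'M[C]_(n.+1 + l.+1, l.+1)); split.
- exact: Ksum.
- rewrite /isometry -[LHS]/((col_mx V E)^t* *m col_mx V E).
  by rewrite adjVE mul_row_col -defE addrC subrK.
- apply/funext => j; rewrite /compress /fp_map fp_eval_direct_sum G0.
  rewrite -[RHS]/((col_mx V E)^t* *m
    (block_mx (fp_eval X (Gamma j)) 0 0 0) *m col_mx V E).
  by rewrite adjVE mul_row_block !mulmx0 !addr0 mul_row_col mul0mx addr0.
Qed.

End Compressions.

Arguments compressions {C g r} Gamma K n _.

Lemma compressions_preimage (C : numClosedFieldType) (g r : nat) (le_gr : (g <= r)%N)
    (Gamma : 'I_r -> free_poly C g)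
    (Gamma_var : forall i : 'I_g, Gamma (widen_ord le_gr i) = fp_var C i)
    (K : nc_set C g) l (Y : 'I_g -> 'M[C]_l.+1) :
  gamma_convex Gamma K -> compressions Gamma K l (fp_map Gamma Y) -> K l Y.
Proof.
move=> [[Ksa _ _ _] Kconv] [n [X [V [KX hV GY]]]].
have defY : compress V X = Y.
  apply/funext => i; have /(congr1 (fun W => W (widen_ord le_gr i))) := GY.
  by rewrite /compress /fp_map Gamma_var !fp_eval_var.
rewrite -defY; apply: Kconv => //; split=> // [|j]; first exact: Ksa.
by rewrite -GY defY.
Qed.

(** * Separation from a cone *)

Section Separation.
Variables (R : realType) (N : nat).
Implicit Types x q c h p : 'rV[R]_N.

Let dot x q := \sum_i x 0 i * q 0 i.

Let dotDr x q c : dot x (q + c) = dot x q + dot x c.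
Proof. by rewrite /dot -big_split; apply: eq_bigr => i _; rewrite mxE mulrDr. Qed.

Let dotZr x (t : R) q : dot x (t *: q) = t * dot x q.
Proof. by rewrite /dot mulr_sumr; apply: eq_bigr => i _; rewrite mxE mulrCA. Qed.

Let dotC x q : dot x q = dot q x.
Proof. by apply: eq_bigr => i _; rewrite mulrC. Qed.

Let dot_ge0 x : 0 <= dot x x.
Proof. by apply: sumr_ge0 => i _; rewrite -expr2 sqr_ge0. Qed.

Let dot_coord x i : (x 0 i) ^+ 2 <= dot x x.
Proof.
rewrite /dot (bigD1 i) //= -expr2 lerDl.
by apply: sumr_ge0 => j _; rewrite -expr2 sqr_ge0.
Qed.

Let dist_continuous p : continuous (fun x => dot (x - p) (x - p)).
Proof.
have -> : (fun x => dot (x - p) (x - p)) =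
    (fun x => \sum_i (x 0 i - p 0 i) * (x 0 i - p 0 i)).
  by apply/funext => x; apply: eq_bigr => i _; rewrite !mxE.
apply: continuous_big => [|i _ x]; first exact: add_continuous.
have coordB : {for x, continuous (fun y : 'rV[R]_N => y 0 i - p 0 i)}.
  by apply: continuousB; [exact: coord_continuous | exact: cst_continuous].
exact: (continuousM coordB coordB).
Qed.

(** Points outside a large box are farther from p than a given a in A, so it is enough to minimize
    over the compact part of A inside the box. *)
Lemma nearest_point (A : set 'rV[R]_N) p : closed A -> A !=set0 ->
  exists2 x, A x & forall y, A y -> dot (x - p) (x - p) <= dot (y - p) (y - p).
Proof.
move=> clA [a Aa]; set f := fun x => dot (x - p) (x - p).
(* If |x_i| > M then |x_i - p_i| > 1 + f a, whose square exceeds f a. *)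
pose M : R := \sum_i `|p 0 i| + (1 + f a).
have f_ge0 x : 0 <= f x by exact: dot_ge0.
pose box := [set x : 'rV[R]_N | forall i, `[- M, M]%classic (x 0 i)].
have far x : ~ box x -> f a < f x.
  move=> nbox; have [i xi] : exists i, ~ `[- M, M]%classic (x 0 i) by apply/existsNP.
  apply: lt_le_trans (dot_coord _ i).
  have pi : `|p 0 i| <= \sum_i `|p 0 i|.
    by rewrite (bigD1 i) //= lerDl sumr_ge0.
  have Mx : M < `|x 0 i|.
    rewrite ltNge; apply/negP => le; apply: xi.
    by rewrite /= in_itv /= -ler_norml.
  have le1 : 1 + f a <= `|(x - p) 0 i|.
    rewrite !mxE; have := lerB_dist (x 0 i) (p 0 i); rewrite /M in Mx; lra.
  rewrite -real_normK ?num_real //.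
  have := f_ge0 a; nra.
have boxa : box a by apply: contrapT => /far; rewrite ltxx.
have cbox : compact (box `&` A).
  apply: compact_closedI => //; apply: (@rV_compact R N (fun=> `[- M, M]%classic)).
  by move=> i; exact: segment_compact.
have [| |x] := EVT_min_rV _ cbox (f := f).
- by exists a.
- apply: continuous_subspaceT; exact: dist_continuous.
rewrite inE => -[bx Ax] minx; exists x => // y Ay.
have [by_|/far/ltW] := pselect (box y); first by apply: minx; rewrite inE.
by apply: le_trans; apply: minx; rewrite inE.
Qed.

(** With x0 the point of the closure of P nearest to p, the vector h = x0 - p separates: minimality
    gives <h, q> >= 0 on P and <h, x0> <= 0, hence <h, p> = <h, x0> - <h, h> < 0. *)
Lemma cone_separation (P : set 'rV[R]_N) p (e : R) :
  P 0 -> (forall x y, P x -> P y -> P (x + y)) ->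
  (forall (t : R) x, 0 <= t -> P x -> P (t *: x)) ->
  0 < e -> (forall q, P q -> exists i, e <= `|q 0 i - p 0 i|) ->
  exists h, (forall q, P q -> 0 <= \sum_i h 0 i * q 0 i) /\ \sum_i h 0 i * p 0 i < 0.
Proof.
move=> P0 PD PZ e0 farp.
have clP (phi : 'rV[R]_N -> 'rV[R]_N) : continuous phi ->
    (forall x, P x -> P (phi x)) -> forall x, closure P x -> closure P (phi x).
  move=> cphi Pphi x clx B /cphi /clx[q [Pq Bq]].
  by exists (phi q); split=> //; exact: Pphi.
have [|x0 clx0 minx0] := @nearest_point (closure P) p (@closed_closure _ P).
  by exists 0; exact: subset_closure.
have px0 : x0 != p.
  apply/eqP => x0p; move: clx0; rewrite x0p => /(_ (ball p e)).
  move=> /(_ (nbhsx_ballx _ _ e0))[q [/farp[k]]].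
  rewrite distrC leNgt => /negP + [_ bq]; apply.
  by have := bq 0 k; rewrite /ball /=.
have expand h t c : dot (h + t *: c) (h + t *: c) =
    dot h h + 2 * t * dot h c + t ^+ 2 * dot c c.
  rewrite dotDr dotZr (dotC (_ + _) h) (dotC (_ + _) c) !dotDr !dotZr (dotC c h).
  ring.
set h := x0 - p.
(* First-order condition at x0: directions that stay in the closure do not decrease the distance to
   p. *)
have small c : (forall t, 0 < t <= 1 -> closure P (x0 + t *: c)) -> 0 <= dot h c.
  move=> clc; rewrite leNgt; apply/negP => hc.
  have c0 : 0 <= dot c c by exact: dot_ge0.
  (* For this t the squared distance would change by 2t<h, c> + t^2<c, c> = t(1 + t)<h, c> < 0. *)
  pose t := - dot h c / (dot c c - dot h c).
  have den : 0 < dot c c - dot h c by lra.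
  have t01 : 0 < t <= 1.
    rewrite /t divr_gt0 ?oppr_gt0 //= ler_pdivrMr // mul1r; lra.
  have := minx0 _ (clc t t01).
  rewrite addrAC -/h expand.
  have tden : t * (dot c c - dot h c) = - dot h c by rewrite /t divfK // gt_eqF.
  have {t01} /andP[t0 t1] := t01.
  nra.
(* Moving from x0 towards the apex 0 stays in the closure of the cone. *)
have hx0 : 0 <= dot h (- x0).
  apply: small => t /andP[t0 t1].
  rewrite (_ : _ + _ = (1 - t) *: x0); last by rewrite scalerBl scale1r scalerN.
  apply: (clP ( *:%R (1 - t))) clx0; first exact: scaler_continuous.
  by move=> x; apply: PZ; rewrite subr_ge0.
exists h; split=> [q Pq|].
  apply: small => t /andP[t0 _]; apply: (clP (fun x => x + t *: q)) clx0 => [x|x Px].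
    apply: (@cvgD R 'rV[R]_N _ (nbhs x) _ (fun x => x) (fun=> t *: q)).
      exact: cvg_id.
    exact: cvg_cst.
  by apply: PD => //; exact: PZ (ltW t0) _.
rewrite -[X in X < 0]/(dot h p) (_ : p = x0 - h); last by rewrite subKr.
rewrite dotDr -scaleN1r dotZr -[x0]opprK -[- - x0]scaleN1r dotZr.
have : 0 < dot h h.
  rewrite lt_neqAle dot_ge0 andbT eq_sym; apply: contra px0 => /eqP hh0.
  rewrite -subr_eq0; apply/eqP/rowP => i; apply/eqP; rewrite [X in _ == X]mxE.
  by rewrite -sqrf_eq0 eq_le sqr_ge0 andbT -hh0 dot_coord.
lra.
Qed.
End Separation.

(** * Separation for tuples of Hermitian matrices *)

Section HermitianSeparation.
Variable R : realType.
Let C := Cplx R.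

Let ReM (z1 z2 : C) : complex.Re (z1 * z2) =
  complex.Re z1 * complex.Re z2 - complex.Im z1 * complex.Im z2.
Proof. by case: z1 z2 => [a b] [c d]. Qed.

Let Re_sum I (s : seq I) (P : pred I) (F : I -> C) :
  complex.Re (\sum_(i <- s | P i) F i) = \sum_(i <- s | P i) complex.Re (F i).
Proof. by apply: (big_morph (@complex.Re R)) => // [[a b] [c d]]. Qed.

Lemma le_norm_ReIm (z : C) :
  `|z| <= (`|complex.Re z| + `|complex.Im z|)%:C%C :> C.
Proof.
rewrite [X in X <= _](normc_def z) (lecR (R := R)).
have s0 : 0 <= `|complex.Re z| + `|complex.Im z| by rewrite addr_ge0.
have := sqrtr_sqr (`|complex.Re z| + `|complex.Im z|); rewrite (ger0_norm s0) => <-.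
apply: ler_wsqrtr; move: (complex.Re z) (complex.Im z) => a b {s0}.
rewrite sqrrD !real_normK ?num_real //.
have := mulr_ge0 (normr_ge0 a) (normr_ge0 b); lra.
Qed.

(** Real and imaginary parts of all entries turn tuples into real row vectors; the functional found
    there is rewritten as a trace pairing with Hermitian coefficients. *)
Lemma hermitian_cone_separation (J : finType) (l : nat)
    (P : set (J -> 'M[C]_l)) (p : J -> 'M[C]_l) (e : R) :
  (forall q, P q -> forall j, q j \is hermsymmx) ->
  (forall j, p j \is hermsymmx) ->
  P (fun=> 0) ->
  (forall x y, P x -> P y -> P (fun j => x j + y j)) ->
  (forall (t : R) x, 0 <= t -> P x -> P (fun j => t%:C%C *: x j)) ->
  0 < e ->
  (forall q, P q -> exists j a b, e%:C%C <= `|q j a b - p j a b| :> C) ->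
  exists B : J -> 'M[C]_l,
    [/\ forall j, B j \is hermsymmx,
        forall q, P q -> 0 <= \sum_j \tr (B j *m q j) &
        \sum_j \tr (B j *m p j) < 0].
Proof.
move=> hP hp P0 PD PZ e0 farp.
pose I : finType := (J * 'I_l * 'I_l * bool)%type.
pose coord (q : J -> 'M[C]_l) (i : I) : R :=
  let z := q i.1.1.1 i.1.1.2 i.1.2 in
  if i.2 then complex.Im z else complex.Re z.
pose enc q : 'rV[R]_#|I| := \row_k coord q (enum_val k).
have [|x y|t x|||h [hP' hp']] := @cone_separation R #|I| (enc @` P) (enc p) (e / 2).
- exists (fun=> 0) => //; apply/rowP => k; rewrite !mxE /coord mxE.
  by case: ifP.
- move=> [x' Px <-] [y' Py <-]; exists (fun j => x' j + y' j); first exact: PD.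
  apply/rowP => k; rewrite !mxE /coord mxE.
  by case: (x' _ _ _) (y' _ _ _) => [a b] [c d]; case: ifP.
- move=> t0 [x' Px <-]; exists (fun j => t%:C%C *: x' j); first exact: PZ.
  apply/rowP => k; rewrite !mxE /coord mxE.
  by case: (x' _ _ _) => [a b]; case: ifP => _ /=; ring.
- by rewrite divr_gt0.
- move=> _ [q Pq <-]; have [j [a [b le_e]]] := farp q Pq.
  have := le_trans le_e (le_norm_ReIm _); rewrite (lecR (R := R)) => {}le_e.
  (* An entry of modulus at least e has real or imaginary part of size at least e / 2. *)
  have [le_im|lt_im] := leP (e / 2) `|complex.Im (q j a b - p j a b)|.
    exists (enum_rank ((j, a, b, true) : I)); rewrite !mxE enum_rankK /coord /=.
    by move: le_im; case: (q j a b) (p j a b) => [? ?] [? ?].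
  exists (enum_rank ((j, a, b, false) : I)); rewrite !mxE enum_rankK /coord /=.
  have : e / 2 <= `|complex.Re (q j a b - p j a b)| by lra.
  by case: (q j a b) (p j a b) => [? ?] [? ?].
pose hh (i : I) := h 0 (enum_rank i).
(* Since Re((u - iv)(x + iy)) = ux + vy, the functional is the real part of the sum of the tr(B'_j
   q_j). *)
pose B' j : 'M[C]_l :=
  \matrix_(b, a) (Complex (hh (j, a, b, false)) (- hh (j, a, b, true)) : C).
have ReF q : complex.Re (\sum_j \tr (B' j *m q j)) = \sum_k h 0 k * enc q 0 k.
  transitivity (\sum_(i : I) hh i * coord q i); last first.
    rewrite (reindex (fun k : 'I_#|I| => enum_val k)) /=; last first.
      by exists enum_rank => i _; [exact: enum_valK | exact: enum_rankK].
    by apply: eq_bigr => k _; rewrite mxE /hh enum_valK.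
  have -> : \sum_(i : I) hh i * coord q i =
      \sum_j \sum_a \sum_b \sum_c hh (j, a, b, c) * coord q (j, a, b, c).
    by rewrite !pair_bigA; apply: eq_bigr => -[[[j a] b] c].
  rewrite Re_sum; apply: eq_bigr => j _.
  rewrite exchange_big /mxtrace Re_sum; apply: eq_bigr => b _.
  rewrite mxE Re_sum; apply: eq_bigr => a _.
  by rewrite big_bool ReM mxE /coord /= mulNr opprK addrC.
(* For Hermitian q, tr(B'^* q) is the conjugate of tr(B' q), so the Hermitian part of B' yields
   exactly the real part. *)
pose B j := 2^-1 *: (B' j + (B' j)^t* ).
have trB q : (forall j, q j \is hermsymmx) ->
    \sum_j \tr (B j *m q j) = (\sum_k h 0 k * enc q 0 k)%:C%C.
  move=> hq; rewrite -ReF (ReJ_add (R := R)) mulrC.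
  rewrite -[X in _ + X]/(Num.conj (\sum_j \tr (B' j *m q j) : C)).
  rewrite rmorph_sum -big_split mulr_sumr /=; apply: eq_bigr => j _.
  rewrite /B -scalemxAl mxtraceZ mulmxDl mxtraceD; congr (_ * (_ + _)).
  by rewrite -mxtrace_adj adjmxM (hermsymmxP _ (hq j)) mxtrace_mulC.
exists B; split.
- move=> j; apply/hermsymmxP; rewrite /B adjmxZ adjmxD trmxCK addrC.
  by rewrite /= conj_Creal ?rpredV ?realn.
- move=> q Pq; rewrite trB; last exact: hP.
  by rewrite (ler0c (R := R)); apply: hP'; exists q.
- by rewrite trB // (ltcR (R := R) _ 0).
Qed.

End HermitianSeparation.

(** * Bounds on Hermitian forms, and forms of tensor products *)

Section Quadratic.
Variable C : numClosedFieldType.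

Lemma hermsymmx_form_real n (D : 'M[C]_n) (v : 'cV[C]_n) :
  D \is hermsymmx -> (v^t* *m D *m v) 0 0 \is Num.real.
Proof.
move/(hermsymmx_conj v)/hermsymmxP => hD.
by apply/CrealP; rewrite -mxE_adj hD.
Qed.

(** Each |v_a| |v_b| is at most half of |v_a|^2 + |v_b|^2; over all pairs (a, b) every square is
    counted n times. *)
Lemma form_entry_bound n (D : 'M[C]_n) (v : 'cV[C]_n) (e : C) :
  0 <= e -> (forall a b, `|D a b| <= e) ->
  `|(v^t* *m D *m v) 0 0| <= e * n%:R * (v^t* *m v) 0 0.
Proof.
move=> e0 De; have -> : (v^t* *m D *m v) 0 0 =
    \sum_b \sum_a (v a 0)^* * D a b * v b 0.
  rewrite mxE; apply: eq_bigr => b _; rewrite mxE mulr_suml.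
  by apply: eq_bigr => a _; rewrite mxE_adj.
have -> : e * n%:R * (v^t* *m v) 0 0 =
    \sum_b \sum_a e * ((`|v a 0| ^+ 2 + `|v b 0| ^+ 2) / 2).
  under eq_bigr do rewrite -mulr_sumr -mulr_suml big_split /=.
  rewrite -mulr_sumr -mulr_suml big_split /= -quad_form_self.
  under [X in _ + X]eq_bigr do rewrite sumr_const card_ord.
  rewrite sumr_const card_ord sumrMnl -quad_form_self -mulr2n -mulrnA mulnC.
  by rewrite -[X in _ = e * (X / 2)]mulr_natr natrM; field.
apply: le_trans (ler_norm_sum _ _ _) _; apply: ler_sum => b _.
apply: le_trans (ler_norm_sum _ _ _) _; apply: ler_sum => a _.
rewrite !normrM norm_conjC -mulrA mulrCA; apply: ler_pM => //.
(* AM-GM *)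
rewrite ler_pdivlMr ?ltr0n // -subr_ge0.
have -> : `|v a 0| ^+ 2 + `|v b 0| ^+ 2 - `|v a 0| * `|v b 0| * 2 =
  (`|v a 0| - `|v b 0|) ^+ 2 by ring.
by rewrite real_exprn_even_ge0 // rpredB.
Qed.

(** For M = V^* V the conclusion says that V / sqrt(1 + e n) is a contraction. It amounts to
    bounding the form of M - 1. *)
Lemma psdmx_near_identity n (M : 'M[C]_n) (e : C) : 0 <= e ->
  M \is hermsymmx -> (forall a b, `|M a b - (1%:M : 'M[C]_n) a b| <= e) ->
  psdmx ((1 + e * n%:R)%:M - M).
Proof.
move=> e0 hM near; set D := M - 1%:M.
have hD : D \is hermsymmx.
  apply/hermsymmxP; rewrite adjmxD (hermsymmxP _ hM).
  by rewrite -[X in X^t*]scaleN1r adjmxZ adjmx1 rmorphN1 scaleN1r.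
have eD : (1 + e * n%:R)%:M - M = (e * n%:R)%:M - D.
  by rewrite /D raddfD /= opprB addrA [X in X - M]addrC.
rewrite eD; split=> [|v].
  apply/hermsymmxP; rewrite adjmxD adjmx_scalar -[X in _ + X^t*]scaleN1r adjmxZ.
  rewrite (hermsymmxP _ hD) rmorphN1 scaleN1r conj_Creal //.
  by rewrite rpredM ?realn // ger0_real.
rewrite mulmxBr mulmxBl mul_mx_scalar -scalemxAl [X in 0 <= X]mxE [X in X + _]mxE.
rewrite [X in _ + X]mxE subr_ge0; apply: le_trans (form_entry_bound v e0 _).
  exact/real_ler_norm/hermsymmx_form_real.
by move=> a b; rewrite !mxE; have := near a b; rewrite mxE.
Qed.

(** Writing v as the sum of the e_a (x) w_a, with w_a the columns of W, both sides are the sum over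
    a, b of A_ab w_a^* G w_b. *)
Lemma tens_form d n (A : 'M[C]_d) (G : 'M[C]_n) (v : 'cV[C]_(d * n)) :
  let W := \matrix_(i < n, a < d) v (mxtens_index (a, i)) 0 in
  (v^t* *m (A *t G) *m v) 0 0 = \tr (A^T *m (W^t* *m G *m W)).
Proof.
move=> W.
have sum_tens (F : 'I_(d * n) -> C) :
    \sum_k F k = \sum_a \sum_i F (mxtens_index (a, i)).
  rewrite pair_bigA (reindex (@mxtens_index d n)) /=.
    by apply: eq_bigr => -[a i].
  by exists (@mxtens_unindex d n) => x _; rewrite ?mxtens_indexK ?mxtens_unindexK.
rewrite mxE sum_tens /mxtrace; apply: eq_bigr => b _.
under eq_bigr do rewrite mxE sum_tens mulr_suml.
rewrite exchange_big mxE /=; apply: eq_bigr => a _.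
rewrite mxE mxE mulr_sumr; apply: eq_bigr => k _.
rewrite mxE mulr_suml mulr_suml mulr_sumr; apply: eq_bigr => i _.
rewrite tensmxE mxE_adj [W^t* _ _]mxE_adj !mxE.
by rewrite !mulrA; congr (_ * _ * _); rewrite mulrC.
Qed.

End Quadratic.

(** * Closure in the product topology through entrywise approximation *)

Section Closure.
Variable R : realType.
Let C := Cplx R.

Lemma closure_entrywise k n (S : set {ptws 'I_k -> 'M[C]_n.+1})
    (f : {ptws 'I_k -> 'M[C]_n.+1}) :
  (forall e : C, 0 < e ->
     exists2 W, S W & forall j a b, `|W j a b - f j a b| < e) ->
  closure S f.
Proof.
move=> near B nB.
pose F : set_system ('I_k -> 'M[C]_n.+1) := filter_from [set e : C | 0 < e]
  (fun e => [set W : 'I_k -> 'M[C]_n.+1 | forall j a b, `|W j a b - f j a b| < e]).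
have FF : Filter F.
  apply: filter_from_filter; first by exists 1; exact: ltr01.
  move=> x y x0 y0; exists (Num.min x y).
    by rewrite /= /Num.min; case: ifP.
  (* The order on C is partial, but positive elements are real, hence comparable. *)
  have xy : (x >=< y)%O by apply: real_comparable; exact: gtr0_real.
  move=> W Wxy; split=> j a b; apply: lt_le_trans (Wxy j a b) _.
    by rewrite comparable_ge_min // lexx.
  by rewrite comparable_ge_min // lexx orbT.
have Ff : F --> (f : {ptws 'I_k -> 'M[C]_n.+1}).
  (* The product topology is a supremum of initial topologies, so convergence is tested one
     coordinate j at a time. *)
  apply/cvg_sup => j A; rewrite nbhsE /= => -[U [[V oV VU] Uf] UA].
  apply: filterS UA _; rewrite -VU.
  have : nbhs (f j) V by apply: open_nbhs_nbhs; split=> //; rewrite -VU in Uf.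
  case=> P nP PV.
  suff : F [set W : 'I_k -> 'M[C]_n.+1 | forall a b, P a b (W j a b)].
    by case=> e e0 eP; exists e => // W We; apply: PV => a b; exact: eP.
  pose Q a b (W : 'I_k -> 'M[C]_n.+1) := P a b (W j a b).
  apply: (@filter_forall _ _ (fun a W => forall b, Q a b W) F FF) => a.
  apply: (@filter_forall _ _ (Q a) F FF) => b.
  have := nP a b; rewrite -nbhs_ballE => -[e /= e0 eP].
  exists e => // W We; apply: eP.
  by rewrite /ball /= distrC; exact: We.
have [e e0 eB] := Ff _ nB; have [W SW We] := near e e0.
by exists W; split=> //; exact: eB.
Qed.
End Closure.

(** * The separating pencil *)

Section Pencil.
Variables (C : numClosedFieldType) (g r : nat) (Gamma : 'I_r -> free_poly C g).

Lemma monic_pencil_form d (A : 'I_r -> 'M[C]_d) n (X : 'I_g -> 'M[C]_n.+1)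
    (v : 'cV[C]_(d * n.+1)) :
  let W := \matrix_(i < n.+1, a < d) v (mxtens_index (a, i)) 0 in
  (v^t* *m monic_pencil Gamma A X *m v) 0 0 =
  \tr (W^t* *m W) + \sum_j \tr ((A j)^T *m (W^t* *m fp_map Gamma X j *m W)).
Proof.
move=> W; rewrite /monic_pencil mulmxDr mulmxDl mxE tens_form trmx1 mul1mx mulmx1.
congr (_ + _); rewrite mulmx_sumr mulmx_suml summxE.
by apply: eq_bigr => j _; rewrite tens_form.
Qed.

Lemma monic_pencil_hermsymmx d (A : 'I_r -> 'M[C]_d) n (X : 'I_g -> 'M[C]_n.+1) :
  selfadjoint A -> selfadjoint (fp_map Gamma X) ->
  monic_pencil Gamma A X \is hermsymmx.
Proof.
move=> hA hX; apply/hermsymmxP; rewrite /monic_pencil adjmxD adjmx_sum.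
rewrite trmx_tens map_mxT !adjmx1; congr (_ + _); apply: eq_bigr => j _.
by rewrite trmx_tens map_mxT (hermsymmxP _ (hA j)) (hermsymmxP _ (hX j)).
Qed.

(* Reading a vector of C^d (x) C^n as an n x d matrix transposes the
   coefficients, see [tens_form]. *)
Definition congr_pencil d (E : 'M[C]_d) (B : 'I_r -> 'M[C]_d) (j : 'I_r) : 'M[C]_d :=
  ((invmx E)^t* *m B j *m invmx E)^T.

Lemma congr_pencil_selfadjoint d (E : 'M[C]_d) B :
  selfadjoint B -> selfadjoint (congr_pencil E B).
Proof.
move=> hB j; rewrite /congr_pencil; have := hermsymmx_conj (invmx E) (hB j).
move: (_ *m _) => M /hermsymmxP hM; apply/hermsymmxP/matrixP => a b.
by move/matrixP/(_ b a): hM; rewrite !mxE.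
Qed.

(** The substitution W = V E^* and cyclicity of the trace turn the form of the monic pencil into a
    functional whose constant term is E^* E. *)
Lemma congr_pencil_form d n (E : 'M[C]_d) B (X : 'I_g -> 'M[C]_n.+1)
    (V : 'M[C]_(n.+1, d)) :
  E \in unitmx -> let W := V *m E^t* in
  \tr (W^t* *m W) +
    \sum_j \tr ((congr_pencil E B j)^T *m (W^t* *m fp_map Gamma X j *m W)) =
  \tr (E^t* *m E *m (V^t* *m V)) +
    \sum_j \tr (B j *m (V^t* *m fp_map Gamma X j *m V)).
Proof.
move=> uE W; have defW : W^t* = E *m V^t* by rewrite adjmxM trmxCK.
have EV : E^t* *m (invmx E)^t* = 1%:M by rewrite -adjmxM mulVmx // adjmx1.
congr (_ + _); first by rewrite defW /W !mulmxA mxtrace_mulC !mulmxA.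
apply: eq_bigr => j _; rewrite trmxK defW /W !mulmxA mulmxKV //.
by rewrite mxtrace_mulC !mulmxA EV mul1mx.
Qed.

End Pencil.

Lemma mxtrace_gram_gt0 (C : numClosedFieldType) n m (V : 'M[C]_(n, m)) :
  V != 0 -> 0 < \tr (V^t* *m V).
Proof.
move=> V0; have -> : \tr (V^t* *m V) = \sum_b ((col b V)^t* *m col b V) 0 0.
  apply: eq_bigr => b _; rewrite !mxE; apply: eq_bigr => a _.
  by rewrite !mxE.
have form_ge0 b : 0 <= ((col b V)^t* *m col b V) 0 0.
  by rewrite quad_form_self sumr_ge0 // => i _; rewrite exprn_ge0.
rewrite lt_neqAle sumr_ge0 ?andbT // eq_sym; apply: contra V0.
move=> /eqP/psumr_eq0P H; apply/eqP/matrixP => a b.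
have /eqP : col b V == 0.
  apply: contraT => /quad_form_self_gt0; rewrite H ?ltxx // => ? _; exact: form_ge0.
by move/matrixP/(_ a 0); rewrite !mxE.
Qed.

Lemma sum_option (V : nmodType) (I : finType) (F : option I -> V) :
  \sum_j F j = F None + \sum_i F (Some i).
Proof.
rewrite (bigD1 None) //=; congr (_ + _).
rewrite (reindex_omap Some id) //=; last by case.
by apply: eq_bigl => i; rewrite eqxx.
Qed.

(** * The functional separating Gamma(Y) from the homogenized cone *)

Section SeparatingFunctional.
Variables (R : realType) (g r : nat).
Let C := Cplx R.
Variables (Gamma : 'I_r -> free_poly C g) (K : nc_set C g).
Arguments K n _ : clear implicits.
Hypothesis Gamma_sym : forall j, fp_symmetric (Gamma j).
Hypothesis K_free : free_set K.
Hypothesis K_0 : K 0%N (fun=> 0).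
Hypothesis Gamma_0 : forall j : 'I_r, fp_eval (fun=> 0 : 'M[C]_1) (Gamma j) = 0.

(* The index [None] is the homogenizing coordinate, at which every X takes the
   value 1: in an element of the cone it carries V^* V. *)
Let homog n (X : 'I_g -> 'M[C]_n.+1) (j : option 'I_r) : 'M[C]_n.+1 :=
  oapp (fp_map Gamma X) 1%:M j.

Let homog_herm n (X : 'I_g -> 'M[C]_n.+1) j :
  selfadjoint X -> homog X j \is hermsymmx.
Proof.
move=> hX; case: j => [j|] /=; first exact: selfadjoint_fp_map.
by apply/hermsymmxP; exact: adjmx1.
Qed.

Let cone l : set (option 'I_r -> 'M[C]_l.+1) :=
  [set q | exists n (X : 'I_g -> 'M[C]_n.+1) (V : 'M[C]_(n.+1, l.+1)),
     K n X /\ q = fun j => V^t* *m homog X j *m V].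

(** Stacking V on W and compressing the direct sum of X and Y adds the two compressions. *)
Let cone_add l x y : @cone l x -> cone y -> cone (fun j => x j + y j).
Proof.
have [_ Ksum _ _] := K_free.
move=> [n [X [V [KX ->]]]] [m [Y [W [KY ->]]]].
exists (n + m.+1)%N, (direct_sum X Y), (col_mx V W : 'M[C]_(n.+1 + m.+1, l.+1)).
split; first exact: Ksum.
apply/funext => j.
have -> : homog (direct_sum X Y : 'I_g -> 'M[C]_((n + m.+1).+1)) j =
    block_mx (homog X j) 0 0 (homog Y j) :> 'M[C]_(n.+1 + m.+1).
  case: j => [j|]; first exact: fp_eval_direct_sum.
  exact: scalar_mx_block.
rewrite -[RHS]/((col_mx V W)^t* *m block_mx _ 0 0 _ *m col_mx V W).
rewrite tr_col_mx map_row_mx mul_row_block !mulmx0 addr0 add0r.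
by rewrite mul_row_col.
Qed.

Let cone_scale l (t : R) x : 0 <= t -> @cone l x -> cone (fun j => t%:C%C *: x j).
Proof.
move=> t0 [n [X [V [KX ->]]]].
exists n, X, (sqrtC (t%:C%C : C) *: V); split=> //; apply/funext => j.
have t0' : 0 <= (t%:C%C : C) by rewrite (ler0c (R := R)).
rewrite adjmxZ -!scalemxAl -scalemxAr scalerA.
by rewrite conj_Creal ?ger0_real ?sqrtC_ge0 // -expr2 sqrtCK.
Qed.

Lemma separating_functional l (Y : 'I_g -> 'M[C]_l.+1) :
  selfadjoint Y -> ~ closure (compressions Gamma K l) (fp_map Gamma Y) ->
  exists (T : 'M[C]_l.+1) (B : 'I_r -> 'M[C]_l.+1),
    [/\ posdefmx T, selfadjoint B,
        forall n (X : 'I_g -> 'M[C]_n.+1) (V : 'M[C]_(n.+1, l.+1)),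
          K n X -> V != 0 ->
          0 < \tr (T *m (V^t* *m V)) +
              \sum_j \tr (B j *m (V^t* *m fp_map Gamma X j *m V)) &
        \tr T + \sum_j \tr (B j *m fp_map Gamma Y j) < 0].
Proof.
move=> hY notcl.
(* Being outside the closure gives a uniform entrywise gap e. *)
have [e e0 far] : exists2 e : C, 0 < e & forall W, compressions Gamma K l W ->
    exists j a b, e <= `|W j a b - fp_map Gamma Y j a b|.
  apply: contrapT => nofar; apply: notcl; apply: closure_entrywise => e e0.
  apply: contrapT => noW; apply: nofar; exists e => // W SW.
  apply: contrapT => noj; apply: noW; exists W => // j a b.
  rewrite real_ltNge ?ger0_real ?(ltW e0) //; apply/negP => le; apply: noj.
  by exists j, a, b.
pose m : C := \sum_j \sum_a \sum_b `|fp_map Gamma Y j a b|.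
have m_ge j a b : `|fp_map Gamma Y j a b| <= m.
  rewrite /m (bigD1 j) //= (bigD1 a) //= (bigD1 b) //= -!addrA lerDl.
  rewrite !addr_ge0 ?sumr_ge0 // => i _; rewrite !sumr_ge0 // => k _.
  by rewrite sumr_ge0.
have m0 : 0 <= m.
  by do 3![apply: sumr_ge0 => ? _].
pose L : C := l.+1%:R.
have L0 : 0 < L by rewrite ltr0n.
have den0 : 0 < 1 + L * m by rewrite ltr_wpDr // mulr_ge0 // ltW.
(* Chosen so that d + d L m = e / 2: d bounds the distance to (1, Gamma(Y)), and d L m the error
   from rescaling V to a contraction. *)
pose d : C := e / 2 / (1 + L * m).
have d0 : 0 < d by rewrite !divr_gt0 // ltr0n.
have dE : d + d * L * m = e / 2.
  by rewrite -mulrA -[X in X + _]mulr1 -mulrDr /d divfK ?gt_eqF.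
have [||||| |q [n [X [V [KX ->]]]]|B [hB Bpos Bneg]] :=
  @hermitian_cone_separation R (option 'I_r) l.+1 (@cone l) (homog Y) (complex.Re d).
- move=> q [n [X [V [KX ->]]]] j; apply/hermsymmx_conj/homog_herm.
  by have [Ksa _ _ _] := K_free; exact: Ksa KX.
- by move=> j; exact: homog_herm.
- exists 0%N, (fun=> 0), 0; split=> //; apply/funext => j.
  by rewrite mulmx0.
- exact: cone_add.
- exact: cone_scale.
- by move: d0; rewrite (ltcE (R := R)) /= => /andP[].
(* A cone element within d of (1, Gamma(Y)) would give, after dividing V by sqrt(t), a compression
   by a contraction closer than e to Gamma(Y). *)
- apply: contrapT => nofar.
  have dR : (complex.Re d)%:C%C = d :> C by apply: RRe_real; exact: gtr0_real.
  have near j a b : `|(V^t* *m homog X j *m V) a b - homog Y j a b| <= d.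
    rewrite real_leNgt ?normr_real ?gtr0_real //; apply/negP => lt; apply: nofar.
    by exists j, a, b; rewrite dR ltW.
  pose t : C := 1 + d * L.
  have dL0 : 0 <= d * L by rewrite mulr_ge0 // ltW.
  have t1 : 1 <= t by rewrite lerDl.
  have t0 : 0 < t by exact: lt_le_trans t1.
  have hVV : V^t* *m V \is hermsymmx by apply/hermsymmxP; rewrite adjmxM trmxCK.
  have psdt : psdmx (t%:M - V^t* *m V).
    apply: psdmx_near_identity => [|//|a1 b1]; first exact: ltW.
    by have := near None a1 b1; rewrite /= mulmx1.
  pose V' := sqrtC t^-1 *: V.
  have scaleV' (G : 'M[C]_n.+1) : V'^t* *m G *m V' = t^-1 *: (V^t* *m G *m V).
    rewrite /V' adjmxZ -!scalemxAl -scalemxAr scalerA.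
    by rewrite conj_Creal ?ger0_real ?sqrtC_ge0 ?invr_ge0 ?(ltW t0) // -expr2 sqrtCK.
  have [] := far (compress V' (fp_map Gamma X)).
    apply: (compressions_contraction K_free K_0 Gamma_0 KX).
    have -> : 1%:M - V'^t* *m V' = t^-1 *: (t%:M - V^t* *m V).
      have := scaleV' 1%:M; rewrite !mulmx1 => ->.
      by rewrite scalerBr scale_scalar_mx mulVf // gt_eqF.
    case: psdt => hpsd ppsd; split=> [|v].
      apply/hermsymmxP; rewrite adjmxZ (hermsymmxP _ hpsd) conj_Creal //.
      by rewrite rpredV gtr0_real.
    by rewrite -scalemxAr -scalemxAl mxE mulr_ge0 ?invr_ge0 ?(ltW t0).
  move=> j [a [b]]; rewrite /compress scaleV' mxE.
  set w := (_ *m V) a b; set y := fp_map Gamma Y j a b.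
  have -> : t^-1 * w - y = t^-1 * ((w - y) - d * L * y).
    rewrite -[X in _ - X = _](mulKf (lt0r_neq0 t0)) -mulrBr.
    by rewrite /t mulrDl mul1r opprD addrA.
  rewrite normrM; apply/negP; rewrite -real_ltNge ?rpredM ?normr_real ?gtr0_real //.
  apply: (@le_lt_trans _ _ (e / 2)); last first.
    by rewrite ltr_pdivrMr ?ltr0n // mulr_natr mulr2n ltrDl.
  rewrite -dE -[leRHS]mul1r; apply: ler_pM => //.
    by rewrite normfV invf_le1 ?normr_gt0 ?gt_eqF // ger0_norm // ltW.
  apply: le_trans (ler_normB _ _) _; apply: lerD; first exact: (near (Some j)).
  rewrite normrM (ger0_norm dL0); exact: ler_wpM2l dL0 _ _ (m_ge j a b).
move: Bneg; rewrite sum_option /= mulmx1; set s := _ + _ => s0.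
(* The added term has trace eps L = - s / 2, so the value at (1, Gamma(Y)) becomes s / 2, still
   negative. *)
pose eps : C := - s / 2 / L.
have eps0 : 0 < eps by rewrite !divr_gt0 ?oppr_gt0 // ltr0n.
exists (B None + eps%:M), (fun j => B (Some j)).
have trT n (X : 'I_g -> 'M[C]_n.+1) (V : 'M[C]_(n.+1, l.+1)) :
    \tr ((B None + eps%:M) *m (V^t* *m V)) +
      \sum_j \tr (B (Some j) *m (V^t* *m fp_map Gamma X j *m V)) =
    eps * \tr (V^t* *m V) + \sum_j \tr (B j *m (V^t* *m homog X j *m V)).
  rewrite sum_option /= mulmx1 mulmxDl mxtraceD mul_scalar_mx mxtraceZ.
  by rewrite addrA [X in X + _]addrC.
split.
- split=> [|v v0].
    apply/hermsymmxP; rewrite adjmxD (hermsymmxP _ (hB _)) adjmx_scalar.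
    by rewrite conj_Creal ?gtr0_real.
  rewrite mulmxDr mulmxDl mxE mul_mx_scalar -scalemxAl [X in _ + X]mxE.
  apply: ltr_wpDl (mulr_gt0 eps0 (quad_form_self_gt0 v0)).
  (* At X = 0 of size 1 with V = v^* only the homogenizing term survives, and nonnegativity on the
     cone reads v^* B_None v >= 0. *)
  have cone_v : cone (fun j => v^t*^t* *m homog (fun=> 0 : 'M[C]_1) j *m v^t* ).
    by exists 0%N, (fun=> 0), (v^t* ).
  have := Bpos _ cone_v.
  rewrite sum_option /= big1 => [|j _].
    by rewrite addr0 mulmx1 trmxCK mulmxA mxtrace_mulC mulmxA trace_mx11.
  by rewrite /fp_map Gamma_0 mulmx0 mul0mx mulmx0 mxtrace0.
- by move=> j; exact: hB.
- move=> n X V KX V0; rewrite trT ltr_wpDr //.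
    by apply: Bpos; exists n, X, V.
  exact: mulr_gt0 eps0 (mxtrace_gram_gt0 V0).
- rewrite mxtraceD mxtrace_scalar addrAC -/s -mulr_natr -/L /eps divfK ?gt_eqF //.
  by rewrite mulNr subr_lt0 ltr_pdivlMr ?ltr0n // mulr_natr mulr2n gtrDl.
Qed.

End SeparatingFunctional.

(** * From the functional to the monic pencil *)

Lemma separating_pencil (R : realType) (g r : nat)
    (Gamma : 'I_r -> free_poly (Cplx R) g) (K : nc_set (Cplx R) g) :
  (forall j : 'I_r, fp_symmetric (Gamma j)) -> free_set K -> K 0%N (fun=> 0) ->
  (forall j : 'I_r, fp_eval (fun=> 0 : 'M[Cplx R]_1) (Gamma j) = 0) ->
  forall (l : nat) (Y : 'I_g -> 'M[Cplx R]_l.+1),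
     selfadjoint Y ->
     ~ nc_closure (matco (nc_image Gamma K)) l (fp_map Gamma Y) ->
     exists A : 'I_r -> 'M[Cplx R]_l.+1,
       [/\ selfadjoint A,
           forall n (X : 'I_g -> 'M[Cplx R]_n.+1),
             K n X -> posdefmx (monic_pencil Gamma A X) &
           ~ psdmx (monic_pencil Gamma A Y)].
Proof.
move=> Gsym Kfree K0 G0 l Y hY.
rewrite /nc_closure matco_compressions // => notcl.
have [T [B [pT hB Bpos Bneg]]] := separating_functional Gsym Kfree K0 G0 hY notcl.
have [E uE defT] := posdefmx_factor pT.
have uEadj : E^t* \in unitmx by rewrite map_unitmx unitmx_tr.
have hA := congr_pencil_selfadjoint E hB.
exists (congr_pencil E B); split=> // [n X KX|[_]].
  have [Ksa _ _ _] := Kfree.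
  split=> [|v v0].
    exact/monic_pencil_hermsymmx/selfadjoint_fp_map/Ksa.
  rewrite monic_pencil_form; set W := \matrix_(i, a) _.
  have defW : W = W *m invmx (E^t* ) *m E^t* by rewrite mulmxKV.
  rewrite {1 2 3 4}defW congr_pencil_form // -defT; apply: Bpos => //.
  apply: contra v0 => /eqP V0; apply/eqP/matrixP => k i; rewrite ord1.
  have W0 : W = 0 by rewrite defW V0 mul0mx.
  rewrite -(mxtens_unindexK k); case: (mxtens_unindex k) => a j.
  move/matrixP/(_ j a): W0; by rewrite !mxE.
(* The matrix of this v is E^*, that is V = 1, so the form of L(Y) at v is the negative value of the
   functional at (1, Gamma(Y)). *)
pose v : 'cV[Cplx R]_(l.+1 * l.+1) :=
  \col_k E^t* (mxtens_unindex k).2 (mxtens_unindex k).1.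
move=> /(_ v); rewrite monic_pencil_form.
have -> : \matrix_(i < l.+1, a < l.+1) v (mxtens_index (a, i)) 0 = 1%:M *m E^t*.
  by rewrite mul1mx; apply/matrixP => i a; rewrite [LHS]mxE [LHS]mxE mxtens_indexK.
rewrite congr_pencil_form // -defT adjmx1 !mulmx1.
under eq_bigr do rewrite mul1mx mulmx1.
by move/(lt_le_trans Bneg); rewrite ltxx.
Qed.

Theorem theorem2p4 (R : realType) (g r : nat) (le_gr : (g <= r)%N)
    (Gamma : 'I_r -> free_poly (Cplx R) g)
    (Gamma_sym : forall j : 'I_r, fp_symmetric (Gamma j))
    (Gamma_var : forall i : 'I_g, Gamma (widen_ord le_gr i) = fp_var (Cplx R) i)
    (K : nc_set (Cplx R) g)
    (K_convex : gamma_convex Gamma K)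
    (K_0 : K 0%N (fun=> 0))
    (Gamma_0 : forall j : 'I_r,
       fp_eval (fun=> 0 : 'M[Cplx R]_1) (Gamma j) = 0) :
  (forall (l : nat) (Y : 'I_g -> 'M[Cplx R]_l.+1),
     selfadjoint Y ->
     ~ nc_closure (matco (nc_image Gamma K)) l (fp_map Gamma Y) ->
     exists A : 'I_r -> 'M[Cplx R]_l.+1,
       [/\ selfadjoint A,
           forall n (X : 'I_g -> 'M[Cplx R]_n.+1),
             K n X -> posdefmx (monic_pencil Gamma A X) &
           ~ psdmx (monic_pencil Gamma A Y)]) /\
  (nc_closed (matco (nc_image Gamma K)) ->
   forall (l : nat) (Y : 'I_g -> 'M[Cplx R]_l.+1),
     selfadjoint Y ->
     ~ K l Y ->
     exists A : 'I_r -> 'M[Cplx R]_l.+1,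
       [/\ selfadjoint A,
           forall n (X : 'I_g -> 'M[Cplx R]_n.+1),
             K n X -> posdefmx (monic_pencil Gamma A X) &
           ~ psdmx (monic_pencil Gamma A Y)]).
Proof.
have [K_free _] := K_convex.
have sep := separating_pencil Gamma_sym K_free K_0 Gamma_0.
split=> // Kclosed l Y hY notKY; apply: sep => //.
rewrite /nc_closure -((closure_id _).1 (Kclosed l)) matco_compressions //.
by move/(compressions_preimage Gamma_var K_convex); exact: notKY.
Qed.
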